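(* Let $\phi = (1+\sqrt{5})/2$. Then the admissible vertex count $\sigma$ of a closed 3-manifold triangulation of size $n$ is bounded above by $O(\phi^{7n}) \simeq O(29.03^n)$. That is, there is a constant $C>0$ such that for every $n \geq 1$ and every closed 3-manifold triangulation $\mathcal{T}$ of size $n$ we have $\sigma(\mathcal{T}) \leq C\,\phi^{7n}$.
   Context: A closed 3-manifold triangulation of size $n$ is a collection of $n$ tetrahedra whose $4n$ triangular faces are affinely identified in $2n$ pairs so that the resulting topological space is a closed 3-manifold. (Faces of the same tetrahedron may be identified, and several vertices or edges of the same tetrahedron may become identified as a consequence of the face gluings.) In each tetrahedron there are four types of normal triangle (one for each vertex $v$, separating $v$ from the other three vertices) and three types of normal quadrilateral (one for each way of splitting the four vertices into two pairs, separating the two pairs). Use coordinates in $\mathbb{R}^{7n}$ indexed by these $7n$ types. The matching equations are the following homogeneous linear equations: for each pair of identified faces $F \leftrightarrow F'$ and each vertex $v$ of $F$, corresponding to the vertex $v'$ of $F'$, let $\Delta,\Delta'$ be the tetrahedra containing $F,F'$ on the two sides of the gluing. Then $t+q = t'+q'$, where $t$ is the coordinate of the triangle type at $v$ in $\Delta$, $q$ is the coordinate of the quadrilateral type in $\Delta$ that pairs $v$ with the vertex of $\Delta$ opposite $F$, and $t',q'$ are defined likewise from $v',F',\Delta'$. The quadrilateral constraints require that, for each tetrahedron, at most one of its three quadrilateral coordinates is non-zero. A vector is admissible if all its coordinates are non-negative, it satisfies the matching equations, and it satisfies the quadrilateral constraints. The projective solution space is the polytope in $\mathbb{R}^{7n}$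 obtained as the cross-section $\sum_i x_i = 1$ of the cone of non-negative vectors satisfying the matching equations. The admissible vertex count $\sigma = \sigma(\mathcal{T})$ is the number of vertices of this polytope that satisfy the quadrilateral constraints. (These are in bijection with the vertex normal surfaces of $\mathcal{T}$.) *)

(* Defs.v *)
From HB Require Import structures.
From Stdlib Require Import Relations.
From mathcomp Require Import all_boot all_order all_algebra all_fingroup finmap.
From mathcomp Require Import all_classical all_reals.
From mathcomp Require Import topology normedtype.
From mathcomp Require Import generic_quotient ring.

Set Implicit Arguments.
Unset Strict Implicit.
Unset Printing Implicit Defensive.

Import Order.TTheory GRing.Theory Num.Theory.
Import numFieldNormedType.Exports.

Local Open Scope classical_set_scope.
Local Open Scope ring_scope.
Local Open Scope quotient_scope.

(** Face [i] of a tetrahedron is the face opposite vertex [i], so the [4n] faces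
    are the pairs [(k, i)].  Face [(k, i)] is identified with face
    [(adj k i, glue k i i)], vertex [v != i] of tetrahedron [k] going to vertex
    [glue k i v] of tetrahedron [adj k i]; the value of [glue k i] at [i] is the
    vertex opposite the target face. *)
Record gluing (n : nat) := Gluing {
  adj : 'I_n -> 'I_4 -> 'I_n;
  glue : 'I_n -> 'I_4 -> {perm 'I_4};
  adjK : forall k i, adj (adj k i) (glue k i i) = k;
  glueK : forall k i, glue (adj k i) (glue k i i) = ((glue k i)^-1)%g;
  glue_neq : forall k i, (adj k i, glue k i i) != (k, i)
}.

Section Realization.
Variable R : realType.

(** The standard tetrahedron, in barycentric coordinates. *)
Definition simplex : set 'rV[R]_4 :=
  [set b | (forall v, 0 <= b 0 v) /\ \sum_v b 0 v = 1].

Section Space.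
Variables (n : nat) (T : gluing n).

Definition tetrahedra : topologicalType := {k : 'I_n & set_type simplex}.

(** [a] lies on face [i] of its tetrahedron, and [b] is its image under the
    affine map extending the vertex map of that face. *)
Definition glued (a b : tetrahedra) : Prop :=
  exists i : 'I_4,
    [/\ set_val (projT2 a) 0 i = 0,
        projT1 b = adj T (projT1 a) i &
        forall v, set_val (projT2 b) 0 (glue T (projT1 a) i v)
                  = set_val (projT2 a) 0 v].

Definition identified (a b : tetrahedra) : bool :=
  `[< clos_refl_sym_trans tetrahedra glued a b >].

Lemma identified_equiv : equiv_class_of identified.
Proof.
split=> [a|a b|b a c].
- by apply/asboolP; exact: rst_refl.
- by apply/asboolP/asboolP; exact: rst_sym.
- by move=> /asboolP ab /asboolP bc; apply/asboolP; exact: rst_trans ab bc.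
Qed.

Definition identified_equiv_rel : equiv_rel tetrahedra :=
  EquivRelPack identified_equiv.

Definition realization : topologicalType :=
  quotient_topology {eq_quot identified_equiv_rel}.

End Space.

Definition homeomorphic (X Y : topologicalType) : Prop :=
  exists (f : X -> Y) (g : Y -> X),
    [/\ continuous f, continuous g, cancel f g & cancel g f].

Definition locally_euclidean (d : nat) (X : topologicalType) : Prop :=
  forall x : X, exists U : set X,
    [/\ open U, U x & homeomorphic (set_type U) 'rV[R]_d].

Definition closed_manifold (d : nat) (X : topologicalType) : Prop :=
  [/\ compact [set: X], hausdorff_space X, @second_countable X
    & locally_euclidean d X].

Definition closed_3manifold_triangulation (n : nat) (T : gluing n) : Prop :=
  closed_manifold 3 (realization T).

End Realization.

Definition is_quad (q : {set {set 'I_4}}) : bool :=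
  finset.partition q [set: 'I_4]%SET && [forall B in q, #|B| == 2].

Definition quad : finType := {q : {set {set 'I_4}} | is_quad q}.

Definition pairs (q : quad) (v w : 'I_4) : bool := [set v; w]%SET \in val q.

Lemma quad_existence (v w : 'I_4) : v != w -> exists q : quad, pairs q v w.
Proof.
move=> vw; pose B := [set v; w]%SET.
have cB : #|B| = 2%N by rewrite cards2 vw.
have cC : #|~: B| = 2%N by have := cardsC B; rewrite cB card_ord => -[].
have qP : is_quad [set B; ~: B]%SET.
  apply/andP; split; last first.
    by apply/forall_inP => A; rewrite !inE => /orP[] /eqP ->; rewrite ?cB ?cC.
  have BC : B != (~: B)%SET.
    apply/eqP => E; have : v \in B by rewrite !inE eqxx.
    by rewrite E !inE eqxx.
  apply/and3P; split.
  - by rewrite /finset.cover big_setU1 ?inE//= big_set1 finset.setUCr.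
  - apply/finset.trivIsetP => A A'; rewrite !inE.
    by do 2 case/orP => /eqP ->; rewrite ?eqxx // => _;
       rewrite -setI_eq0 ?finset.setICr // finset.setIC finset.setICr.
  - by rewrite !inE !(eq_sym finset.set0) -!cards_eq0 cB cC.
by exists (Sub _ qP); rewrite /pairs /= !inE eqxx.
Qed.

Lemma pairsE (q : quad) (v w : 'I_4) : v != w -> pairs q v w ->
  val q = [set [set v; w]; ~: [set v; w]]%SET.
Proof.
rewrite /pairs; case: q => q /= /andP[/and3P[/eqP qT /finset.trivIsetP tI _]].
move=> /forall_inP c2 vw vwq.
have cC : #|~: [set v; w]%SET| = 2%N.
  by have := cardsC [set v; w]%SET; rewrite cards2 vw card_ord => -[].
have H A : A \in q -> A != [set v; w]%SET -> A = (~: [set v; w])%SET.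
  move=> Aq Avw; have := tI _ _ Aq vwq Avw; rewrite finset.disjoints_subset.
  by move=> sA; apply/eqP; rewrite eqEcard sA cC (eqP (c2 _ Aq)).
have [u uC] : exists u, u \in (~: [set v; w])%SET.
  by apply/set0Pn; rewrite -cards_eq0 cC.
have : u \in finset.cover q by rewrite qT inE.
move=> /finset.bigcupP[A Aq uA].
have Avw : A != [set v; w]%SET.
  by apply/eqP => E; move: uC; rewrite -E finset.in_setC uA.
apply/finset.setP => B; rewrite !inE; apply/idP/orP => [Bq|].
  by have [->|/(H _ Bq)->] := eqVneq B [set v; w]%SET; rewrite ?eqxx; [left|right].
by case=> /eqP ->; rewrite // -(H _ Aq Avw).
Qed.

Lemma quad_unicity (q q' : quad) (v w : 'I_4) :
  v != w -> pairs q v w -> pairs q' v w -> q = q'.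
Proof.
by move=> vw qvw q'vw; apply: val_inj; rewrite (pairsE vw qvw) (pairsE vw q'vw).
Qed.

Lemma card_quad : #|quad| = 3%N.
Proof.
have nz i : ord0 != lift ord0 i :> 'I_4 by rewrite -val_eqE.
pose f (i : 'I_3) : quad := xchoose (quad_existence (nz i)).
have fP i : pairs (f i) ord0 (lift ord0 i) by exact: xchooseP (quad_existence (nz i)).
have fI : injective f.
  move=> i j fij; have := fP j; rewrite -fij {1}/pairs (pairsE (nz i) (fP i)).
  rewrite !inE => /orP[] /eqP /finset.setP.
    by move=> /(_ (lift ord0 j)); rewrite !inE eqxx orbT eq_sym (negPf (nz _)) /=
      => /esym/eqP/lift_inj ->.
  by move=> /(_ ord0); rewrite !inE eqxx.
have fS q : exists i, f i = q.
  suff [i qi] : exists i, pairs q ord0 (lift ord0 i).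
    by exists i; exact: quad_unicity (nz i) (fP i) qi.
  case: q => q qP; rewrite /pairs /=.
  have /andP[/and3P[/eqP qT _ _] /forall_inP c2] := qP.
  have : ord0 \in finset.cover q by rewrite qT inE.
  move=> /finset.bigcupP[A Aq A0].
  have := c2 _ Aq; rewrite (cardsD1 ord0) A0 eqSS => /cards1P[w Aw].
  have : w \in (A :\ ord0)%SET by rewrite Aw inE.
  rewrite !inE eq_sym => /andP[/unlift_some[i wi _] _].
  by exists i; rewrite -wi -Aw finset.setD1K.
have [g fg] := choice fS.
suff : bijective f by move/bij_eq_card; rewrite card_ord => <-.
by exists g => // i; apply: fI; rewrite fg.
Qed.

(** [(k, inl v)] is the triangle at vertex [v] of tetrahedron [k], and
    [(k, inr q)] the quadrilateral of type [q] in tetrahedron [k]. *)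
Definition disc (n : nat) : finType := ('I_n * ('I_4 + quad))%type.

Lemma card_disc (n : nat) : #|disc n| = (7 * n)%N.
Proof. by rewrite card_prod card_sum !card_ord card_quad mulnC. Qed.

Section NormalCoordinates.
Variables (R : realType) (n : nat) (T : gluing n).
Implicit Type x : {ffun disc n -> R}.

Definition matching x : Prop :=
  forall (k : 'I_n) (i v : 'I_4), v != i ->
  forall q q' : quad, pairs q v i -> pairs q' (glue T k i v) (glue T k i i) ->
    x (k, inl v) + x (k, inr q) =
    x (adj T k i, inl (glue T k i v)) + x (adj T k i, inr q').

Definition quad_constraints x : Prop :=
  forall (k : 'I_n) (q q' : quad),
    x (k, inr q) != 0 -> x (k, inr q') != 0 -> q = q'.

Definition projective_solution_space : set {ffun disc n -> R} :=
  [set x : {ffun disc n -> R} | [/\ forall d, 0 <= x d, matching x & \sum_d x d = 1]].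

End NormalCoordinates.

Definition extreme_point (R : realType) (E : lmodType R) (A : set E) : set E :=
  [set x | A x /\ forall (y z : E) (t : R), A y -> A z -> 0 < t < 1 ->
             x = t *: y + (1 - t) *: z -> y = x /\ z = x].

Section Count.
Variables (R : realType) (n : nat) (T : gluing n).

Definition admissible_vertices : set {ffun disc n -> R} :=
  [set x | extreme_point (projective_solution_space T) x /\ quad_constraints x].

Lemma finite_admissible_vertices : finite_set admissible_vertices.
Proof.
pose supp (x : {ffun disc n -> R}) := [set d | x d != 0]%SET.
suff inj : {in admissible_vertices &, injective supp}.
  by rewrite -(eq_finite_set (inj_card_eq inj)); exact: finite_finset.
move=> x y /set_mem[[Px ex] _] /set_mem[[Py _] _] sxy.
have [x0 xm x1] := Px; have [y0 ym y1] := Py.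
have le1 (z : {ffun disc n -> R}) : (forall d, 0 <= z d) -> \sum_d z d = 1 ->
    forall d, z d <= 1.
  move=> z0 z1 d; rewrite -z1 (bigD1 d) //= lerDl.
  by apply: sumr_ge0 => e _.
pose e := \prod_(d | x d != 0) x d.
have e0 : 0 < e.
  by apply: prodr_gt0 => d xd; rewrite lt_neqAle eq_sym xd x0.
have ex_le d : x d != 0 -> e <= x d.
  move=> xd; rewrite /e (bigD1 d) //= ler_piMr //.
  by apply: prodr_ile1 => i _; rewrite x0 le1.
pose z := x + e *: (x - y).
have zE d : z d = x d + e * (x d - y d).
  by rewrite !ffunE.
have Pz : projective_solution_space T z.
  split.
  - move=> d; rewrite zE; have [xd|xd] := eqVneq (x d) 0.
      have yd : y d = 0.
        by apply/eqP; have /finset.setP/(_ d) := sxy; rewrite !inE xd eqxx => /esym/negbFE.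
      by rewrite xd yd subrr mulr0 addr0.
    rewrite mulrBr addrCA addr_ge0 ?mulr_ge0 // ?(ltW e0) // subr_ge0.
    by apply: le_trans (ex_le _ xd); rewrite ler_piMr ?le1 // ltW.
  - move=> k i v vi q q' h h'; rewrite !zE.
    have hx := xm _ _ _ vi _ _ h h'; have hy := ym _ _ _ vi _ _ h h'.
    rewrite addrACA -mulrDr addrACA -opprD hx hy.
    by rewrite opprD addrACA mulrDr addrACA.
  - under eq_bigr do rewrite zE.
    by rewrite big_split /= -mulr_sumr sumrB x1 y1 subrr mulr0 addr0.
have e1 : 1 + e != 0 by rewrite gt_eqF // addr_gt0.
have [] := ex z y (1 + e)^-1 Pz Py.
- by rewrite invr_gt0 addr_gt0 //= invf_lt1 ?addr_gt0 // ltrDl.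
- apply/ffunP => d; rewrite !ffunE.
  by rewrite /GRing.scale /=; field.
- by [].
Qed.

Definition admissible_vertex_count : nat := #|` fset_set admissible_vertices|.

End Count.

(* Main.v *)
Require Import Defs.
From mathcomp Require Import all_boot all_order all_algebra.
From mathcomp Require Import all_classical all_reals.
From mathcomp Require Import normedtype.
From mathcomp Require Import all_fingroup finmap ring lra zify.

Set Implicit Arguments.
Unset Strict Implicit.
Unset Printing Implicit Defensive.

Import Order.TTheory GRing.Theory Num.Theory.
Import numFieldNormedType.Exports.
Local Open Scope ring_scope.

(** The bound holds for the number of vertices of any polytope cut out of the
    standard simplex of [N] nonnegative coordinates by linear equations, and is
    applied with [N = 7n].  By the upper bound theorem, a polytope of dimension
    [d] with at most [N] facets has at most [2 * 'C(N - d + k, k)] vertices,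
    where [k] is the integer part of [d / 2].  With [r = N - d], the number
    ['C(r + k, k)] is one term of the diagonal sum of Pascal's triangle that
    gives a Fibonacci number, and it is at most [phi ^+ (r + 2 * k)]
    ([bin_le_phi]); since [r + 2 * k <= N], the constant [C = 2] suffices.

    The vertex count follows Alon and Kalai.  Fix a linear functional [c] that
    separates the vertices.  At a vertex [v] with support [S v], the
    coordinates outside [S v] span, on the affine hull of the polytope, the
    affine functions that vanish at [v], so [c - c v] is a combination of [d]
    of them ([nonbasic_coordinates]); let [Up v] and [Dn v] be the coordinates
    with positive and with negative coefficient.  A vertex [w] with
    [c w > c v] has a positive coordinate in [Up v], and one with [c w < c v]
    has a positive coordinate in [Dn v].  One of [Up v], [Dn v] has at most [k]
    elements, and supports have at most [N - d].  So the vertices fall into two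
    classes, each with a system of set pairs as in the skew version of
    Bollobas's theorem ([skew_bollobas]), which limits each class to
    ['C(N - d + k, k)] members.

    Working with supports and with a choice of [d] independent coordinates at
    each vertex treats degenerate vertices in the same way as simple ones;
    extremality enters through the fact that a vertex is determined up to
    scaling by its support ([extreme_point_support]). *)

(** * Skew set pairs *)

(** Such a product is a form of degree [r] in the [k + 1] coefficients of [p i],
    and there are only ['C(r + k, r)] monomials of that degree.  A monomial is
    encoded as the sorted tuple of the indices of its variables. *)
Lemma rank_prod_horner_le (F : fieldType) (m k r : nat)
    (p : 'I_m -> {poly F}) (s : 'I_m -> r.-tuple F) :
  (forall i, size (p i) <= k.+1)%N ->
  (\rank (\matrix_(i, j) \prod_(t <- s j) (p i).[t])%R <= 'C(r + k, r))%N.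
Proof.
move=> sp; rewrite -card_sorted_tuples; set W := [set _ | _]%SET.
pose sorted_codom (f : {ffun 'I_r -> 'I_k.+1}) : r.-tuple 'I_k.+1 :=
  sort_tuple (fun a b : 'I_k.+1 => a <= b)%N [tuple f l | l < r].
have scW f : sorted_codom f \in W.
  rewrite inE sorted_map.
  apply: (@sort_sorted _ (fun a b : 'I_k.+1 => a <= b)%N).
  by move=> a b; exact: leq_total.
pose X := \matrix_(i < m, w < #|W|) \prod_(e <- enum_val w) (p i)`_e.
pose Y := \matrix_(w < #|W|, j < m)
  \sum_(f : {ffun 'I_r -> 'I_k.+1} | sorted_codom f == enum_val w)
     \prod_l tnth (s j) l ^+ f l.
suff -> : \matrix_(i, j) \prod_(t <- s j) (p i).[t] = X *m Y.
  exact: mulmx_max_rank.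
apply/matrixP => i j; rewrite !mxE big_tuple.
under eq_bigr do rewrite (horner_coef_wide _ (sp i)).
rewrite bigA_distr_bigA /=.
rewrite (partition_big sorted_codom (fun w => w \in W)) //=.
rewrite big_enum_val /=; apply: eq_bigr => w _; rewrite !mxE big_distrr /=.
apply: eq_bigr => f /eqP <-; rewrite big_split /=; congr (_ * _).
by rewrite (perm_big [tuple f l | l < r]) ?perm_sort //= big_map big_enum.
Qed.

(** Listing the indices by increasing [c] makes [M] triangular.  Without the
    reordering: a permutation that contributes to the determinant never
    increases [c], hence preserves it, hence is the identity. *)
Lemma mxrank_triangular_order (F : fieldType) (m : nat) (R : realDomainType)
    (c : 'I_m -> R) (M : 'M[F]_m) :
  injective c -> (forall i, M i i != 0) ->
  (forall i j, c i < c j -> M i j = 0) -> \rank M = m.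
Proof.
move=> c_inj Mii M0; apply/eqP; rewrite -[_ == _]/(row_free M) row_free_unit.
rewrite unitmxE unitfE /determinant (bigD1 1%g) //= [X in _ + X]big1 => [|s s1].
  rewrite addr0 odd_perm1 mul1r; apply/prodf_neq0 => i _; by rewrite perm1.
suff [i ci] : exists i, c i < c (s i).
  by rewrite (bigD1 i) //= M0 // mul0r mulr0.
apply/existsP; apply: contraNT s1 => /existsPn c_le; apply/eqP/permP => i.
have cs_le j : c (s j) <= c j by rewrite leNgt c_le.
have : \sum_j (c j - c (s j)) = 0.
  by rewrite sumrB [X in X - _](reindex_inj (@perm_inj _ s)) /= subrr.
move/eqP; rewrite psumr_eq0 => [/allP/(_ i)|j _]; last by rewrite subr_ge0.
by rewrite mem_index_enum subr_eq0 perm1 => /(_ isT)/eqP/c_inj.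
Qed.

(** Give the elements of [I] distinct scalars [t a], and encode [U i] as the
    polynomial [p i] with roots [t a], [a] in [U i].  The product of the values
    of [p i] over [S j] vanishes exactly when [U i] meets [S j], so the matrix
    of these products is triangular for the order of [c]; its rank is both
    [#|Q|] and at most the number of monomials. *)
Lemma skew_bollobas (T I : finType) (R : realDomainType) (c : T -> R)
    (U S : T -> {set I}) (Q : {set T}) (k r : nat) :
  injective c ->
  (forall i, i \in Q -> #|U i| <= k)%N ->
  (forall i, i \in Q -> #|S i| <= r)%N ->
  (forall i, i \in Q -> [disjoint U i & S i]) ->
  (forall i j, i \in Q -> j \in Q -> c i < c j -> ~~ [disjoint U i & S j]) ->
  (#|Q| <= 'C(r + k, k))%N.
Proof.
move=> c_inj Uk Sr US_disj US_meet.
pose t (a : I) : rat := (enum_rank a)%:R.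
have t_inj : injective t.
  by move=> a b /eqP; rewrite eqr_nat => /eqP/val_inj/enum_rank_inj.
(* No [p i] vanishes at [tinf], which pads every [S j] to exactly [r] points. *)
pose tinf : rat := #|I|%:R.
have tinfE a : tinf != t a by rewrite eqr_nat gtn_eqF.
pose p (i : 'I_#|Q|) : {poly rat} := \prod_(a in U (enum_val i)) ('X - (t a)%:P).
pose sj (j : 'I_#|Q|) :=
  nseq (r - #|S (enum_val j)|) tinf ++ [seq t b | b in S (enum_val j)].
have sj_size j : size (sj j) == r.
  by rewrite size_cat size_nseq size_map -cardE subnK // Sr // enum_valP.
pose s j := Tuple (sj_size j).
have rootp i b : ((p i).[t b] == 0) = (b \in U (enum_val i)).
  rewrite horner_prod; apply/prodf_eq0/idP => [[a aU]|bU].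
    by rewrite hornerXsubC subr_eq0 => /eqP/t_inj ->.
  by exists b => //; rewrite hornerXsubC subrr.
have prodE i j : (\prod_(x <- s j) (p i).[x] == 0) =
                 ~~ [disjoint U (enum_val i) & S (enum_val j)].
  rewrite big_cat /= mulf_eq0 big_map prodf_seq_eq0.
  have -> /= : (has (fun x => xpredT x && ((p i).[x] == 0))
     (nseq (r - #|S (enum_val j)|) tinf)) = false.
    apply/negbTE/hasPn => x /nseqP[-> _] /=; rewrite horner_prod.
    by apply/prodf_neq0 => a _; rewrite hornerXsubC subr_eq0.
  rewrite prodf_seq_eq0 /=; apply/hasP/pred0Pn => /= [[b]|[b /andP[bU bS]]].
    by rewrite mem_enum rootp => bS bU; exists b; rewrite /= bU.
  by exists b; rewrite ?mem_enum ?rootp.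
have sp i : (size (p i) <= k.+1)%N.
  by rewrite /p -big_enum size_prod_XsubC -cardE ltnS Uk ?enum_valP.
have := rank_prod_horner_le s sp.
rewrite -bin_sub ?leq_addr // addKn; apply: leq_trans.
rewrite (@mxrank_triangular_order _ _ _ (c \o enum_val)) //.
- by apply: inj_comp; [exact: c_inj|exact: enum_val_inj].
- by move=> i; rewrite mxE prodE negbK US_disj ?enum_valP.
- by move=> i j cij; rewrite mxE; apply/eqP; rewrite prodE US_meet ?enum_valP.
Qed.

(** * Vertices of a section of the simplex *)

(** Along the moment curve [t |-> (1, t, t^2, ...)] the difference of the values
    at two distinct rows is a nonzero polynomial in [t], so all but finitely
    many [t] separate all rows. *)
Lemma exists_injective_functional (R : numFieldType) (m N : nat)
    (A : 'M[R]_(m, N)) :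
  injective (fun i => row i A) ->
  exists g : 'cV[R]_N, injective (fun i => (A *m g) i 0).
Proof.
move=> A_inj; pose p i := rVpoly (row i A).
pose P := \prod_(ij : 'I_m * 'I_m | ij.1 != ij.2) (p ij.1 - p ij.2).
have P0 : P != 0.
  apply/prodf_neq0 => -[i j] /= ij; rewrite subr_eq0.
  by apply: contraNneq ij => /(can_inj rVpolyK)/A_inj ->.
have [t Pt] : exists t : R, P.[t] != 0.
  pose ts := [seq (a%:R : R) | a <- iota 0 (size P)].
  have ts_uniq : uniq ts.
    rewrite map_inj_uniq ?iota_uniq // => a b /eqP.
    by rewrite eqr_nat => /eqP.
  have [ts_roots|] := boolP (all (root P) ts); last first.
    by case/allPn => t _ Pt; exists t.
  have := max_poly_roots P0 ts_roots ts_uniq.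
  by rewrite size_map size_iota ltnn.
have pE i : (p i).[t] = (A *m \col_j t ^+ j) i 0.
  by rewrite horner_poly mxE; apply: eq_bigr => j _; rewrite valK !mxE.
exists (\col_j t ^+ j) => i j eq_ij; apply/eqP; apply: contraNT Pt => ij.
rewrite horner_prod; apply/prodf_eq0; exists (i, j) => //=.
by rewrite hornerD hornerN !pE eq_ij subrr.
Qed.

(** Think of row [i] of [A] as a vertex, with support [S], of a polytope whose
    affine hull is that of the rows and so has dimension [(\rank A).-1].  Then
    [J] plays the part of the nonbasic variables of a simplex tableau at [i].  The last hypothesis says that the
    linear forms [x_j], [j] outside [S], have the line of vertex [i] as common
    zeros in the row space of [A].  By duality they span the forms that vanish
    at that vertex, and [J] is a basis extracted from them. *)
Lemma nonbasic_coordinates (R : fieldType) (m N : nat) (A : 'M[R]_(m, N))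
    (i : 'I_m) (S : {set 'I_N}) :
  (forall i', \sum_j A i' j = 1) ->
  (forall j, j \notin S -> A i j = 0) ->
  (forall b : 'rV[R]_m, (forall j, j \notin S -> (b *m A) 0 j = 0) ->
     exists mu, b *m A = mu *: row i A) ->
  exists J : {set 'I_N},
    [/\ [disjoint J & S], #|J| = (\rank A).-1 &
        forall g : 'cV[R]_N, exists lam : 'I_N -> R, forall i',
          (A *m g) i' 0 - (A *m g) i 0 = \sum_(j in J) lam j * A i' j].
Proof.
move=> A1 Ai vertex_i.
pose B : 'M[R]_(N, m) := \matrix_(j, i') if j \in S then 0 else A i' j.
pose e : 'rV[R]_m := const_mx 1.
have eE : (e^T = A *m const_mx 1)%R.
  apply/matrixP => i' z; rewrite !mxE -[LHS](A1 i'); apply: eq_bigr => j _.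
  by rewrite mxE mulr1.
pose w (g : 'cV[R]_N) : 'rV[R]_m := (A *m g)^T - (A *m g) i 0 *: e.
(* Duality: [w g] is annihilated by all that annihilates [B], by [vertex_i]. *)
have wB g : (w g <= B)%MS.
  rewrite submxE; apply/eqP/matrixP => z k; rewrite (ord1 z) [RHS]mxE.
  pose b : 'rV[R]_m := (col k (cokermx B))^T.
  have [|mu bA] := vertex_i b.
    move=> j jS; have /matrixP/(_ j k) := mulmx_coker B.
    rewrite [RHS]mxE => <-; rewrite !mxE; apply: eq_bigr => i' _.
    by rewrite !mxE (negbTE jS) mulrC.
  have -> : (w g *m cokermx B) 0 k = (b *m (w g)^T) 0 0.
    by rewrite !mxE; apply: eq_bigr => i' _; rewrite !mxE mulrC.
  rewrite linearB /= linearZ /= trmxK eE mulmxBr -scalemxAr !mulmxA bA.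
  rewrite -!scalemxAl -!row_mul -eE !mxE.
  by ring.
(* The forms vanishing at [i] have codimension one: [e], the sum of all
   coordinates, supplies the missing direction. *)
have AB : (A^T <= B + e)%MS.
  apply/row_subP => j.
  have -> : row j A^T = w (delta_mx j 0) + A i j *: e.
    have Aj i' : (A *m delta_mx j 0 : 'cV_m) i' 0 = A i' j.
      by rewrite -colE mxE.
    apply/rowP => i'; have := Aj i'; have := Aj i; rewrite !mxE => -> ->.
    by ring.
  by rewrite addmx_sub_adds ?wB // scalemx_sub.
have BA : (B < A^T)%MS.
  rewrite ltmxE; apply/andP; split.
    apply/row_subP => j; have [jS|jS] := boolP (j \in S).
      suff -> : row j B = 0 by rewrite sub0mx.
      by apply/rowP => i'; rewrite !mxE jS.
    suff -> : row j B = row j A^T by rewrite row_sub.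
    by apply/rowP => i'; rewrite !mxE (negbTE jS).
  apply/negP => AsubB.
  have : (e <= B)%MS.
    apply: submx_trans AsubB; apply/submxP; exists (const_mx 1).
    by rewrite -[LHS]trmxK eE trmx_mul trmx_const.
  case/submxP => x /rowP/(_ i); rewrite !mxE big1 => [/eqP|j _].
    by rewrite oner_eq0.
  by rewrite mxE; case: ifP => [_|/negbT/Ai ->]; rewrite mulr0.
have rankB : \rank B = (\rank A).-1.
  have lt := rank_ltmx BA; rewrite mxrank_tr in lt.
  have le : (\rank A <= \rank B + 1)%N.
    rewrite -mxrank_tr; apply: leq_trans (mxrankS AB) _.
    by rewrite (leq_trans (mxrank_adds_leqif _ _)) // leq_add2l rank_leq_row.
  by apply/eqP; rewrite eqn_leq -ltnS (ltn_predK lt) lt -subn1 leq_subLR addnC.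
pose f := maxrankfun B; have f_inj : injective f := @maxrankfun_inj _ _ _ B.
have f_notin x : f x \notin S.
  apply/negP => fxS.
  have : row x (rowsub f B) = 0 by apply/rowP => i'; rewrite !mxE fxS.
  have /row_freeP[D] := maxrowsub_free B; rewrite -/f => fBD rx0.
  have /matrixP/(_ x x) := fBD; rewrite [RHS]mxE eqxx => /eqP.
  have -> : (rowsub f B *m D) x x = (row x (rowsub f B) *m D) 0 x.
    by rewrite -row_mul [RHS]mxE.
  by rewrite rx0 mul0mx mxE eq_sym oner_eq0.
exists (f @: [set: 'I_(\rank B)])%SET; split.
- rewrite finset.disjoints_subset; apply/fintype.subsetP => j /imsetP[x _ ->].
  by rewrite inE f_notin.
- by rewrite card_imset ?cardsT ?card_ord.
move=> g; have : (w g <= rowsub f B)%MS by rewrite eq_maxrowsub wB.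
case/submxP => x xE.
exists (fun j => \sum_(y | f y == j) x 0 y) => i'.
transitivity (w g 0 i'); first by rewrite !mxE; ring.
rewrite big_imset /=; last by move=> ? ? _ _; exact: f_inj.
rewrite xE !mxE; apply: eq_big => [y|y _]; first by rewrite inE.
rewrite (big_pred1 y) => [|z]; last by rewrite (inj_eq f_inj).
by rewrite !mxE (negbTE (f_notin y)).
Qed.

(** [A] lists vertices of a polytope in the standard simplex; the last hypothesis
    says that each is determined up to scaling by its zero coordinates.  The
    witnesses are [k = d./2] and [r = N - d], for [d] the dimension of the hull
    of the rows. *)
Lemma vertex_count_le (R : realFieldType) (m N : nat) (A : 'M[R]_(m, N)) :
  injective (fun i => row i A) ->
  (forall i j, 0 <= A i j) ->
  (forall i, \sum_j A i j = 1) ->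
  (forall i (b : 'rV[R]_m), (forall j, A i j = 0 -> (b *m A) 0 j = 0) ->
     exists mu, b *m A = mu *: row i A) ->
  exists k r : nat, (r + 2 * k <= N)%N /\ (m <= 2 * 'C(r + k, k))%N.
Proof.
move=> A_inj A0 A1 vertex.
have [g g_inj] := exists_injective_functional A_inj.
pose c i := (A *m g) i 0; set d := (\rank A).-1.
pose S i := [set j | A i j != 0]%SET.
have /choice[J JP] : forall i, exists J : {set 'I_N},
    [/\ [disjoint J & S i], #|J| = d &
     forall g : 'cV[R]_N, exists lam : 'I_N -> R, forall i',
       (A *m g) i' 0 - (A *m g) i 0 = \sum_(j in J) lam j * A i' j].
  move=> i; apply: nonbasic_coordinates => // [j|b bS].
    by rewrite inE negbK => /eqP.
  by apply: vertex => j Aij; apply: bS; rewrite inE Aij eqxx.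
have /choice[lam lamP] : forall i, exists lam : 'I_N -> R, forall i',
    c i' - c i = \sum_(j in J i) lam j * A i' j.
  by move=> i; have [_ _ /(_ g)] := JP i.
have dN : (d <= N)%N by apply: leq_trans (leq_pred _) (rank_leq_col A).
have S_card i : (#|S i| <= N - d)%N.
  have [JS <- _] := JP i; rewrite leq_subRL; last first.
    by rewrite -[X in (_ <= X)%N]card_ord max_card.
  by have /leqifP := leq_card_setU (J i) (S i); rewrite JS => /eqP <-;
     rewrite -[X in (_ <= X)%N]card_ord max_card.
pose Up i := [set j in J i | 0 < lam i j]%SET.
pose Dn i := [set j in J i | lam i j < 0]%SET.
have UpS i : [disjoint Up i & S i].
  have [JS _ _] := JP i; apply: disjointWl JS.
  by apply/fintype.subsetP => j; rewrite inE => /andP[].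
have DnS i : [disjoint Dn i & S i].
  have [JS _ _] := JP i; apply: disjointWl JS.
  by apply/fintype.subsetP => j; rewrite inE => /andP[].
have UpDn i : (#|Up i| + #|Dn i| <= d)%N.
  have [_ <- _] := JP i.
  have disj : [disjoint Up i & Dn i].
    apply/pred0P => j; rewrite /= !inE.
    apply/negP => /andP[/andP[_ p] /andP[_ q]].
    by have := lt_trans p q; rewrite ltxx.
  have /leqifP := leq_card_setU (Up i) (Dn i); rewrite disj => /eqP <-.
  apply: subset_leq_card; apply/fintype.subsetP => j.
  by rewrite !inE => /orP[] /andP[].
(* [c j - c i] is a combination of nonnegative coordinates of [j], so if it is
   positive, a positive coefficient meets a positive coordinate. *)
have Up_meet i j : c i < c j -> ~~ [disjoint Up i & S j].
  rewrite -subr_gt0 lamP; apply: contraTN => /pred0P disj.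
  rewrite -leNgt; apply: sumr_le0 => l lJ.
  have := disj l; rewrite /= !inE lJ /=.
  have [->|Ajl] := eqVneq (A j l) 0; first by rewrite mulr0.
  by rewrite andbT => /negbT; rewrite -leNgt => ?; rewrite mulr_le0_ge0.
have Dn_meet i j : - c i < - c j -> ~~ [disjoint Dn i & S j].
  rewrite ltrN2 -subr_lt0 lamP; apply: contraTN => /pred0P disj.
  rewrite -leNgt; apply: sumr_ge0 => l lJ.
  have := disj l; rewrite /= !inE lJ /=.
  have [->|Ajl] := eqVneq (A j l) 0; first by rewrite mulr0.
  by rewrite andbT => /negbT; rewrite -leNgt => ?; rewrite mulr_ge0.
exists d./2, (N - d)%N; split.
  by rewrite -{2}(subnK dN) leq_add2l mul2n -{2}(odd_double_half d) leq_addl.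
(* [Up i] and [Dn i] cannot both exceed [d./2]; the vertices for which [Dn i]
   is the small one are counted with the opposite order. *)
pose Q := [set i | (#|Up i| <= d./2)%N]%SET.
have Q_card : (#|Q| <= 'C(N - d + d./2, d./2))%N.
  apply: (@skew_bollobas _ _ _ c Up S) => // i; first by rewrite inE.
  by move=> j _ _; exact: Up_meet.
have Qc_card : (#|~: Q| <= 'C(N - d + d./2, d./2))%N.
  apply: (@skew_bollobas _ _ _ (fun i => - c i) Dn S) => //
    [i j /oppr_inj/g_inj //|i|i j _ _].
    rewrite !inE -ltnNge => ltU; have := UpDn i; lia.
  exact: Dn_meet.
by rewrite -[m]card_ord -(cardsC Q) mul2n -addnn leq_add.
Qed.

Lemma golden_ratio_ge1 (R : rcfType) : 1 <= (1 + Num.sqrt 5) / 2 :> R.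
Proof.
have : 1 <= Num.sqrt 5 :> R by rewrite -[leLHS]sqrtr1 ler_wsqrtr ?ler1n.
lra.
Qed.

(** Pascal's rule lowers the weight [r + 2 * k] by one or by two, in step with
    [phi ^+ 2 = phi + 1]. *)
Lemma bin_le_phi (R : rcfType) (r k : nat) :
  'C(r + k, k)%:R <= ((1 + Num.sqrt 5) / 2 : R) ^+ (r + 2 * k).
Proof.
set phi : R := _ / 2.
have sqrt5 : Num.sqrt 5 ^+ 2 = 5 :> R by rewrite sqr_sqrtr.
have phi2 : phi ^+ 2 = phi + 1 by rewrite /phi; nra.
have phi1 : 1 <= phi := golden_ratio_ge1 R.
elim: r k => [k|r IHr]; first by rewrite add0n binn; apply: exprn_ege1.
elim=> [|k IHk]; first by rewrite bin0; apply: exprn_ege1.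
rewrite addSn binS natrD.
apply: (@le_trans _ _ (phi ^+ (r + 2 * k.+1) + phi ^+ (r.+1 + 2 * k))).
  by apply: lerD; [exact: IHr|rewrite -addSnnS; exact: IHk].
have -> : (r.+1 + 2 * k.+1 = r.+1 + 2 * k + 2)%N by lia.
have -> : (r + 2 * k.+1 = r.+1 + 2 * k + 1)%N by lia.
by rewrite !exprD expr1 phi2 mulrDr mulr1.
Qed.

(** * Vertex normal surfaces *)

(** Subtracting from [y] its multiple of [x] with the same coordinate sum gives a
    direction [z] along which both [x + eps *: z] and [x - eps *: z] stay in the
    polytope for small [eps]; extremality forces [z = 0]. *)
Lemma extreme_point_support (R : realType) (n : nat) (T : gluing n)
    (x y : {ffun disc n -> R}) :
  extreme_point (@projective_solution_space R n T) x -> matching T y ->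
  (forall d, x d = 0 -> y d = 0) -> y = (\sum_d y d) *: x.
Proof.
move=> [[x0 xm x1] x_ext] ym yx; set mu := \sum_d y d.
pose z := y - mu *: x.
have zE d : z d = y d - mu * x d by rewrite !ffunE.
have z_sum : \sum_d z d = 0.
  under eq_bigr do rewrite zE.
  by rewrite sumrB -mulr_sumr x1 mulr1 subrr.
have zm : matching T z.
  move=> k i v vi q q' h h'; rewrite !zE.
  have hx := xm _ _ _ vi _ _ h h'; have hy := ym _ _ _ vi _ _ h h'.
  by rewrite addrACA -opprD -mulrDr hx hy mulrDr opprD addrACA.
have zx d : x d = 0 -> z d = 0 by move=> xd; rewrite zE yx // xd mulr0 subrr.
have [eps eps_gt0 eps_le] : exists2 eps : R, 0 < eps &
    forall d, eps * `|z d| <= x d.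
  (* [e] is a lower bound for the nonzero coordinates of [x], all of them being
     at most 1, and [M] an upper bound for those of [z]. *)
  pose M := 1 + \sum_d `|z d|.
  have M_gt0 : 0 < M by rewrite ltr_pwDl // sumr_ge0.
  have zM d : `|z d| <= M.
    rewrite /M (bigD1 d) //= addrCA lerDl addr_ge0 ?sumr_ge0 //.
  have x_le1 d : x d <= 1.
    by rewrite -x1 (bigD1 d) //= lerDl sumr_ge0.
  pose e := \prod_(d | x d != 0) x d.
  have e_gt0 : 0 < e.
    by apply: prodr_gt0 => d xd; rewrite lt_neqAle eq_sym xd x0.
  exists (e / M) => [|d]; first by rewrite divr_gt0.
  have [xd|xd] := eqVneq (x d) 0; first by rewrite zx // normr0 mulr0 xd.
  apply: (@le_trans _ _ e).
    by rewrite -mulrA ler_piMr ?(ltW e_gt0) // mulrC ler_pdivrMr // mul1r.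
  rewrite /e (bigD1 d) //= ler_piMr //.
  by apply: prodr_ile1 => d' _; rewrite x0 x_le1.
have in_space (s : R) : `|s| <= eps ->
    projective_solution_space T (x + s *: z).
  have sE d : (x + s *: z) d = x d + s * z d by rewrite !ffunE.
  move=> s_le; split.
  - move=> d; rewrite sE -lerBlDl sub0r lerNl; apply: le_trans (eps_le d).
    by rewrite (le_trans (ler_norm _)) // normrN normrM ler_wpM2r.
  - move=> k i v vi q q' h h'; rewrite !sE addrACA -mulrDr.
    rewrite (xm _ _ _ vi _ _ h h') (zm _ _ _ vi _ _ h h').
    by rewrite mulrDr addrACA.
  - under eq_bigr do rewrite sE.
    by rewrite big_split /= -mulr_sumr z_sum mulr0 addr0.
have [] := x_ext (x + eps *: z) (x + - eps *: z) (1 / 2).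
- by apply: in_space; rewrite gtr0_norm.
- by apply: in_space; rewrite normrN gtr0_norm.
- by lra.
- by apply/ffunP => d; rewrite !ffunE /GRing.scale /=; field.
move=> /eqP; rewrite -[eqbRHS]addr0 (inj_eq (addrI x)) scaler_eq0 gt_eqF //=.
by rewrite subr_eq0 => /eqP.
Qed.

Theorem theorem1 (R : realType) :
  exists C : R, 0 < C /\
    forall (n : nat) (T : gluing n), (1 <= n)%N ->
      closed_3manifold_triangulation R T ->
      (admissible_vertex_count R T)%:R
        <= C * ((1 + Num.sqrt 5) / 2) ^+ (7 * n).
Proof.
exists 2; split=> // n T _ _.
set phi : R := _ / 2; set m := admissible_vertex_count R T.
pose v (i : 'I_m) := tnth (in_tuple (fset_set (@admissible_vertices R n T))) i.
have v_inj : injective v by apply/tuple_uniqP; exact: fset_uniq.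
have v_ext i : extreme_point (@projective_solution_space R n T) (v i).
  have := mem_tnth i (in_tuple (fset_set (@admissible_vertices R n T))).
  rewrite -/(v i) in_fset_set; last exact: finite_admissible_vertices.
  by move=> /set_mem[].
pose A : 'M[R]_(m, #|disc n|) := \matrix_(i, j) v i (enum_val j).
have rowA i d : A i (enum_rank d) = v i d by rewrite mxE enum_rankK.
have A_inj : injective (fun i => row i A).
  move=> i i' /rowP eq_ii'; apply: v_inj; apply/ffunP => d.
  by have := eq_ii' (enum_rank d); rewrite !mxE enum_rankK.
have [|||k [r [kr m_le]]] := vertex_count_le A_inj.
- by move=> i j; rewrite mxE; have [[]] := v_ext i.
- move=> i; have [[_ _ v1] _] := v_ext i.
  rewrite -[RHS]v1 [RHS](reindex_onto enum_val enum_rank) /= => [|d _].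
    by apply: eq_big => j; rewrite ?enum_valK ?eqxx // mxE.
  by rewrite enum_rankK.
- move=> i b bA; pose y := \sum_i' b 0 i' *: v i'.
  have yE d : y d = \sum_i' b 0 i' * v i' d.
    by rewrite sum_ffunE; apply: eq_bigr => i' _; rewrite ffunE.
  have bAE j : (b *m A) 0 j = y (enum_val j).
    by rewrite mxE yE; apply: eq_bigr => i' _; rewrite mxE.
  have ym : matching T y.
    move=> t f u uf q q' h h'; rewrite !yE -!big_split /=.
    apply: eq_bigr => i' _; rewrite -!mulrDr; congr (_ * _).
    by have [[_ vm _] _] := v_ext i'; exact: vm.
  exists (\sum_d y d); apply/rowP => j; rewrite bAE.
  rewrite [in LHS](extreme_point_support (v_ext i) ym).
    by rewrite !mxE ffunE.
  by move=> d vd; rewrite -[d]enum_rankK -bAE bA // rowA.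
apply: (@le_trans _ _ (2 * 'C(r + k, k)%:R)); first by rewrite -natrM ler_nat.
rewrite ler_pM2l // (le_trans (bin_le_phi _ _ _)) //.
by apply: ler_weXn2l; rewrite ?golden_ratio_ge1 // -card_disc.
Qed.
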